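(* There exists a constant $C>0$ such that for all primes $n$ and all $x \in \mathbb{R}$, $$\left| \mathbb{P}\left(\frac{A_n - \mu_n}{\sigma_n} \le x\right) - \mathbb{P}(Z \le x) \right| \le C\, n^{-1/4},$$ where $Z$ is a standard normal random variable.
   Context: Let $n$ be prime and let $x_i$, $i \in \mathbb{Z}/n\mathbb{Z}$, be independent Bernoulli random variables with $\mathbb{P}(x_i = 1) = \mathbb{P}(x_i=0) = \frac12$ (so $x_i$ is the indicator that $i$ belongs to a uniformly random subset $S\subseteq\mathbb{Z}/n\mathbb{Z}$). The number of 3-term arithmetic progressions in $S$ is $$A_n = \frac12 \sum_{i=1}^{n}\sum_{j=1}^{n-1} x_i x_{i+j} x_{i+2j},$$ with indices taken modulo $n$. Write $\mu_n = \mathbb{E}[A_n]$ and let $\sigma_n>0$ be the standard deviation of $A_n$. *)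

(* Defs.v *)
From HB Require Import structures.
From mathcomp Require Import all_boot all_order all_algebra.
From mathcomp Require Import all_classical all_reals all_analysis.

Set Implicit Arguments.
Unset Strict Implicit.
Unset Printing Implicit Defensive.

Import Order.TTheory GRing.Theory Num.Theory.
Import numFieldNormedType.Exports.

Local Open Scope classical_set_scope.
Local Open Scope ring_scope.

(* Mutual independence: the product rule for every subfamily J and all Borel
   events. *)
Definition mutually_independent (d : measure_display) (T : measurableType d)
    (R : realType) (P : probability T R) (I : finType)
    (X : I -> {RV P >-> R}) : Prop :=
  forall (J : {set I}) (B : I -> set R),
    (forall i, i \in J -> measurable (B i)) ->
    P (\bigcap_(i in [set i | i \in J]) (X i @^-1` B i)) =
    (\prod_(i in J) P (X i @^-1` B i))%E.

Definition bernoulli_half (d : measure_display) (T : measurableType d)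
    (R : realType) (P : probability T R) (X : {RV P >-> R}) : Prop :=
  P (X @^-1` [set 1]) = (2^-1)%:E /\ P (X @^-1` [set 0]) = (2^-1)%:E.

(* The number A_n of 3-term progressions.  The type 'Z_n is Z/nZ only when
   1 < n, which holds for the prime n considered here; the arithmetic on
   indices is that of Z/nZ, and the term j = 0 is the omitted j = n. *)
Definition ap3_count (T : Type) (R : realType) (n : nat)
    (x : 'Z_n -> T -> R) (t : T) : R :=
  2^-1 * \sum_(i : 'Z_n) \sum_(j : 'Z_n | j != 0)
           x i t * x (i + j) t * x (i + j *+ 2) t.

Definition mean (d : measure_display) (T : measurableType d) (R : realType)
    (P : probability T R) (Y : T -> R) : R :=
  fine 'E_P[Y].

Definition std_dev (d : measure_display) (T : measurableType d) (R : realType)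
    (P : probability T R) (Y : T -> R) : R :=
  Num.sqrt (fine 'V_P[Y]).

(* Main.v *)
(** Write [x_i = (1 + e_i) / 2] with [e_i] a random sign and [S = sum_i e_i].
    Expanding the product of three factors gives
    [16 (A - E A) = 3 (n - 1) S + Q] with
    [Q = 3 (S^2 - n) + sum_(i, j <> 0) e_i e_(i+j) e_(i+2j)].  The variable [Q]
    is uncorrelated with [S] and [E Q^2 <= 54 n^2], whereas the linear term has
    variance [9 (n - 1)^2 n]; so [A] is normalised like its linear part up to a
    factor [1 + O(1/n)], and [Q] is negligible by Chebyshev's inequality.

    For [S] itself, [E f (x + h S)] is the [n]-th iterate of the averaging
    operator [f |-> (f (x + h) + f (x - h)) / 2].  On the Gaussian distribution
    function of variance [s], one step of this operator agrees with increasing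
    the variance by [h^2] up to [10 h^4 / s^2] (fourth order Taylor expansion).
    Starting from variance [d^2], these errors add up to [O(h^2 / d^2)].  With
    [u = n^(-1/8)] one takes [h = u^4], smoothing scale [d = u^3], tail cut-off
    [K = 1/u] and Chebyshev threshold [t = u^2]; every error is then
    [O(u^2) = O(n^(-1/4))]. *)

Require Import Defs.
From HB Require Import structures.
From mathcomp Require Import all_boot all_order all_algebra ring lra.
From mathcomp Require Import all_classical all_reals all_analysis measurable_realfun.
Import Order.TTheory GRing.Theory Num.Theory.
Import numFieldNormedType.Exports.
Local Open Scope classical_set_scope.
Local Open Scope ring_scope.

(** * The Gaussian density and mean value estimates *)

Definition Phi {R : realType} (y : R) : R :=
  fine (normal_prob 0 1 [set z : R | z <= y]).

Definition gauss_pdf {R : realType} (z : R) : R := normal_pdf 0 1 z.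

Lemma gauss_pdfE {R : realType} (z : R) :
  gauss_pdf z = normal_peak 1 * expR (- z ^+ 2 / 2).
Proof.
by rewrite /gauss_pdf normal_pdfE ?oner_neq0// /normal_fun subr0 expr1n.
Qed.

Lemma is_derive_gauss_pdf {R : realType} (z : R) :
  is_derive z (1 : R) gauss_pdf (- (z * gauss_pdf z)).
Proof.
have -> : gauss_pdf = (normal_peak 1 : R) \*: (expR \o ((- 2^-1) \*: (id * id))).
  apply/funext => x; rewrite gauss_pdfE/= !fctE /GRing.scale/=; congr (_ * expR _).
  by rewrite expr2; ring.
apply: is_derive_eq.
by rewrite !fctE /= /GRing.scale /=; field.
Qed.

Lemma is_derive_Phi {R : realType} (y : R) :
  is_derive y (1 : R) Phi (gauss_pdf y).
Proof.
have int : lebesgue_measure.-integrable setT (EFin \o (gauss_pdf : R -> R)).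
  exact: integrable_normal_pdf.
(* The half-line extends to [y + 1] so that [y] is an interior point for the fundamental theorem of
   calculus. *)
have iy : lebesgue_measure.-integrable `]-oo, (y + 1)] (EFin \o (gauss_pdf : R -> R)).
  exact: integrableS int.
have yy : y < y + 1 by rewrite ltrDl.
have cy : {for y, continuous (gauss_pdf : R -> R)}.
  by apply: continuous_normal_pdf; exact: oner_neq0.
have [d e] := continuous_FTC1 yy iy (ltNyr y) cy.
have -> : Phi = (fun x : R => \int[lebesgue_measure]_(t in `]-oo, x]) gauss_pdf t)%R.
  by apply: funext => x; rewrite /Phi /normal_prob /Rintegral set_itvNyc.
by apply: (DeriveDef d); rewrite -derive1E; exact: e.
Qed.

Lemma gauss_pdf_ge0 {R : realType} (z : R) : 0 <= gauss_pdf z.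
Proof. exact: normal_pdf_ge0. Qed.

Lemma gauss_pdf_le_expR {R : realType} (z : R) :
  gauss_pdf z <= (expR (z ^+ 2 / 2))^-1.
Proof.
rewrite gauss_pdfE mulNr expRN ler_piMl ?invr_ge0 ?expR_ge0//.
rewrite /normal_peak expr1n mul1r invf_le1; last first.
  by rewrite sqrtr_gt0 mulrn_wgt0// pi_gt0.
rewrite -[leLHS]sqrtr1 ler_sqrt ?nnegrE//; last by rewrite mulrn_wge0// pi_ge0.
by have := @pi_ge2 R; lra.
Qed.

(** Squaring [1 + z^2/4 <= expR (z^2/4)] gives the claim. Degree four suffices to dominate the cubic
    factor bounded below. *)
Lemma expR_half_sqr_ge {R : realType} (z : R) :
  1 + z ^+ 2 / 2 + z ^+ 4 / 16 <= expR (z ^+ 2 / 2).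
Proof.
have -> : z ^+ 2 / 2 = z ^+ 2 / 4 + z ^+ 2 / 4 by field.
rewrite expRD -expr2.
have := expR_ge1Dx (z ^+ 2 / 4); have := sqr_ge0 z.
set e := expR _; set a := z ^+ 2; have -> : z ^+ 4 = a ^+ 2 by rewrite /a; ring.
by move=> *; nra.
Qed.

Lemma norm_mul_gauss_pdf_le {R : realType} (p z C : R) :
  `|p| <= C * (1 + z ^+ 2 / 2 + z ^+ 4 / 16) -> 0 <= C ->
  `|p * gauss_pdf z| <= C.
Proof.
move=> hp C0; rewrite normrM (ger0_norm (gauss_pdf_ge0 z)).
apply: (@le_trans _ _ (`|p| * (expR (z ^+ 2 / 2))^-1)).
  by rewrite ler_wpM2l// gauss_pdf_le_expR.
rewrite ler_pdivrMr ?expR_gt0//; apply: (le_trans hp).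
by rewrite ler_wpM2l// expR_half_sqr_ge.
Qed.

Lemma gauss_pdf_le1 {R : realType} (z : R) : `|gauss_pdf z| <= 1.
Proof.
rewrite -[gauss_pdf z]mul1r; apply: norm_mul_gauss_pdf_le => //.
by rewrite normr1 mul1r; have := sqr_ge0 z; have := sqr_ge0 (z ^+ 2); rewrite -exprM; lra.
Qed.

Lemma norm_id_gauss_pdf_le1 {R : realType} (z : R) : `|z * gauss_pdf z| <= 1.
Proof.
apply: norm_mul_gauss_pdf_le => //; rewrite mul1r.
have := sqr_ge0 (z ^+ 2); rewrite -exprM -(real_normK (num_real z)) => ?.
by have := sqr_ge0 (`|z| - 1); nra.
Qed.

(** The function bounded here is the third derivative of the density, hence the fourth derivative of
    [Phi]. It controls both Taylor remainders below. *)
Lemma norm_cubic_gauss_pdf_le8 {R : realType} (z : R) :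
  `|(3 * z - z ^+ 3) * gauss_pdf z| <= 8.
Proof.
apply: norm_mul_gauss_pdf_le => //.
apply: (le_trans (ler_normB _ _)); rewrite normrM normrX (ger0_norm (_ : 0 <= 3))//.
have -> : z ^+ 4 = `|z| ^+ 4 by rewrite -normrX ger0_norm// (exprM z 2 2) sqr_ge0.
rewrite -(real_normK (num_real z)).
have := normr_ge0 z; set a := `|z|.
(* These squares give [3 a <= 3 (a^2 + 1) / 2] and [a^3 <= (a^4 + a^2) / 2]. The coefficient 1/2 of
   [a^4], compared with [C / 16], dictates [C = 8]. *)
have := sqr_ge0 (a - 1); have := sqr_ge0 (a ^+ 2 - a); rewrite !sqrrB.
have -> : (a ^+ 2) ^+ 2 = a ^+ 4 by ring.
have -> : a ^+ 2 * a = a ^+ 3 by ring.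
by move=> *; have := sqr_ge0 a; lra.
Qed.

(** One mean value step. Chained through successive derivatives vanishing at 0, it yields Taylor
    remainders; the factor [1 / (m + 1)] of exact integration is given up. *)
Lemma norm_le_of_is_derive {R : realType} {f f' : R -> R} {K : R} {m : nat} :
  (forall t : R, 0 <= t -> is_derive t (1 : R) f (f' t)) -> f 0 = 0 -> 0 <= K ->
  (forall t, 0 <= t -> `|f' t| <= K * t ^+ m) ->
  forall t, 0 <= t -> `|f t| <= K * t ^+ m.+1.
Proof.
move=> df f0 K0 bf t t0.
have dft x : x \in `]0, t[ -> is_derive x 1 f (f' x).
  by rewrite in_itv/= => /andP[/ltW/df].
have cf : {within `[0, t], continuous f}.
  apply: derivable_within_continuous => x; rewrite in_itv/= => /andP[/df dx _].
  exact: ex_derive.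
have [c + fc] := MVT_segment t0 dft cf.
rewrite in_itv/= => /andP[c0 ct].
move: fc; rewrite f0 !subr0 => ->.
rewrite normrM (ger0_norm t0) exprSr mulrA ler_wpM2r//.
by rewrite (le_trans (bf _ c0))// ler_wpM2l// lerXn2r.
Qed.

Lemma norm_sub_le_of_is_derive {R : realType} {f f' : R -> R} {K a b : R} :
  (forall t : R, a <= t -> is_derive t (1 : R) f (f' t)) -> a <= b ->
  (forall t, a <= t -> `|f' t| <= K) -> `|f b - f a| <= K * (b - a).
Proof.
move=> df ab bf.
have dfb x : x \in `]a, b[ -> is_derive x 1 f (f' x).
  by rewrite in_itv/= => /andP[/ltW/df].
have cf : {within `[a, b], continuous f}.
  apply: derivable_within_continuous => x; rewrite in_itv/= => /andP[/df dx _].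
  exact: ex_derive.
have [c + ->] := MVT_segment ab dfb cf.
rewrite in_itv/= => /andP[c0 ct].
by rewrite normrM [`|b - a|]ger0_norm ?subr_ge0// ler_wpM2r ?subr_ge0// bf.
Qed.

(** * The Gaussian distribution function *)

Lemma Phi_ge0 {R : realType} (y : R) : 0 <= Phi y.
Proof. exact/fine_ge0/measure_ge0. Qed.

Lemma measurable_ray {R : realType} (y : R) : measurable [set z : R | z <= y].
Proof. by rewrite -set_itvNyc; exact: measurable_itv. Qed.

Lemma normal_prob_ray_fin {R : realType} (y : R) :
  normal_prob 0 1 [set z : R | z <= y] \is a fin_num.
Proof. by apply: fin_num_measure; exact: measurable_ray. Qed.

Lemma Phi_le1 {R : realType} (y : R) : Phi y <= 1.
Proof.
rewrite -lee_fin /Phi fineK; last exact: normal_prob_ray_fin.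
apply: probability_le1; exact: measurable_ray.
Qed.

Lemma Phi_homo {R : realType} : {homo (Phi : R -> R) : x y / x <= y}.
Proof.
move=> x y xy; apply: fine_le; [exact: normal_prob_ray_fin..|].
apply: le_measure; rewrite ?inE; [exact: measurable_ray..|].
by move=> z /= /le_trans; exact.
Qed.

(* On [V] the density at [z] is at most [expR (- c ^+ 2 / 2)] times the density
   centred at [c]. *)
Lemma normal_prob_tail {R : realType} (c : R) (V : set R) :
  measurable V -> (forall z, V z -> c ^+ 2 <= c * z) -> c != 0 ->
  (normal_prob 0 1 V <= (2 / c ^+ 2)%:E)%E.
Proof.
move=> mV hV c0.
have mpdf m : measurable_fun V (normal_pdf m 1 : R -> R).
  by apply: measurable_funTS; exact: measurable_normal_pdf.
apply: (@le_trans _ _ ((expR (- c ^+ 2 / 2))%:E * normal_prob c 1 V)%E).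
  rewrite /normal_prob -ge0_integralZl ?lee_fin ?expR_ge0//; last 2 first.
  - by apply/measurable_EFinP; exact: mpdf.
  - by move=> z _; rewrite lee_fin normal_pdf_ge0.
  apply: ge0_le_integral => //=.
  - by move=> z _; rewrite lee_fin normal_pdf_ge0.
  - by apply/measurable_EFinP; exact: mpdf.
  - by apply: measurable_funeM; by apply/measurable_EFinP; exact: mpdf.
  move=> z /hV cz; rewrite -EFinM lee_fin !normal_pdfE ?oner_neq0// /normal_fun.
  rewrite mulrCA -expRD ler_wpM2l ?normal_peak_ge0// ler_expR subr0 expr1n.
  by move: cz; rewrite sqrrB (mulrC c z); lra.
apply: (@le_trans _ _ ((expR (- c ^+ 2 / 2))%:E * 1)%E).
  by rewrite lee_wpmul2l ?lee_fin ?expR_ge0// probability_le1.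
have c2 : 0 < c ^+ 2 by rewrite exprn_even_gt0.
rewrite mule1 lee_fin mulNr expRN -[2 / _]invf_div lef_pV2 ?posrE ?expR_gt0 ?divr_gt0//.
by apply: le_trans (expR_ge1Dx _); lra.
Qed.

Lemma Phi_lower_tail {R : realType} (K : R) : 0 < K -> Phi (- K) <= 2 / K ^+ 2.
Proof.
move=> K0; rewrite -lee_fin /Phi fineK; last exact: normal_prob_ray_fin.
rewrite -[K ^+ 2]sqrrN; apply: normal_prob_tail.
- exact: measurable_ray.
- by move=> z /= zK; nra.
- by rewrite oppr_eq0 gt_eqF.
Qed.

Lemma Phi_upper_tail {R : realType} (K : R) : 0 < K -> 1 - Phi K <= 2 / K ^+ 2.
Proof.
move=> K0; rewrite -lee_fin EFinB /Phi fineK; last exact: normal_prob_ray_fin.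
rewrite -probability_setC; last exact: measurable_ray.
apply: normal_prob_tail.
- by apply: measurableC; exact: measurable_ray.
- by move=> z /= /negP; rewrite -ltNge => zK; nra.
- by rewrite gt_eqF.
Qed.

Lemma is_derive_affine {R : realType} (a b t : R) :
  is_derive t (1 : R) (fun u => a + b * u) b.
Proof.
have -> : (fun u => a + b * u) = cst a + b \*: id by [].
by apply: is_derive_eq; rewrite add0r /GRing.scale/= mulr1.
Qed.

Lemma is_derive_comp_affine {R : realType} (f : R -> R) (a b t d : R) :
  is_derive (a + b * t) (1 : R) f d ->
  is_derive t (1 : R) (fun u => f (a + b * u)) (d * b).
Proof.
by move=> df; apply: (@is_derive1_comp _ f (fun u => a + b * u)); exact: is_derive_affine.
Qed.

Lemma Phi_lipschitz {R : realType} (a b : R) : a <= b -> `|Phi b - Phi a| <= b - a.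
Proof.
move=> ab; rewrite -[leRHS]mul1r; apply: (@norm_sub_le_of_is_derive _ _ gauss_pdf) => // t _.
  exact: is_derive_Phi.
exact: gauss_pdf_le1.
Qed.

(** The derivative of [Phi (t * y)] in [t] is [y * gauss_pdf (t * y)]. For [t >= 1] its modulus is
    at most that of [z * gauss_pdf z] at [z = t * y], so the bound is uniform in [y]. *)
Lemma Phi_dilate {R : realType} (y r : R) : 1 <= r -> `|Phi (r * y) - Phi y| <= r - 1.
Proof.
move=> r1.
have d (t : R) : 1 <= t -> is_derive t (1 : R)
    (fun t => Phi (t * y)) (gauss_pdf (t * y) * y).
  move=> _.
  have -> : (fun t => Phi (t * y)) = (fun t => Phi (0 + y * t)).
    by apply: funext => u; rewrite add0r mulrC.
  rewrite (mulrC t y) -[y * t]add0r.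
  apply: is_derive_comp_affine; exact: is_derive_Phi.
suff b (t : R) : 1 <= t -> `|gauss_pdf (t * y) * y| <= 1.
  by have := norm_sub_le_of_is_derive d r1 b; rewrite !mul1r.
move=> t1; apply: le_trans (norm_id_gauss_pdf_le1 (t * y)).
rewrite mulrC !normrM ler_wpM2r// ler_peMl// ger0_norm//.
exact: le_trans t1.
Qed.

(** As a function of [h], the expression vanishes at 0 together with its first three derivatives,
    and its fourth derivative is a sum of two terms bounded by 8. *)
Lemma norm_second_difference_Phi_le {R : realType} (x h : R) : 0 <= h ->
  `|Phi (x + h) + Phi (x - h) - 2 * Phi x + x * gauss_pdf x * h ^+ 2| <= 16 * h ^+ 4.
Proof.
pose p1 (z : R) : R := - (z * gauss_pdf z).
pose p2 (z : R) : R := (z ^+ 2 - 1) * gauss_pdf z.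
pose p3 (z : R) : R := (3 * z - z ^+ 3) * gauss_pdf z.
have d1 (z : R) : is_derive z (1 : R) gauss_pdf (p1 z) by exact: is_derive_gauss_pdf.
have d2 (z : R) : is_derive z (1 : R) p1 (p2 z).
  have -> : p1 = - (id * gauss_pdf) by [].
  by apply: is_derive_eq; rewrite /p2 /p1 /GRing.scale/=; ring.
have d3 (z : R) : is_derive z (1 : R) p2 (p3 z).
  have -> : p2 = (id * id - cst 1) * gauss_pdf.
    by apply: funext => u; rewrite /p2 !fctE/= expr2.
  by apply: is_derive_eq; rewrite /p3 /p1 !fctE /GRing.scale/=; ring.
have dp (f g : R -> R) (e t : R) : (forall z : R, is_derive z (1 : R) f (g z)) ->
    is_derive t (1 : R) (fun u => f (x + e * u)) (g (x + e * t) * e).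
  by move=> ?; exact: is_derive_comp_affine.
(* All of [f0], ..., [f3] have this shape up to a constant, with [a] alternating between 1 and -1,
   so one computation serves for the four derivatives. *)
have dsum (f g : R -> R) (a b c t : R) :
    (forall z : R, is_derive z (1 : R) f (g z)) ->
    is_derive t (1 : R)
      (fun u => f (x + 1 * u) + a * f (x + -1 * u) + (b * u + c * (u * u)))
      (g (x + 1 * t) - a * g (x + -1 * t) + (b + 2 * c * t)).
  move=> fg; have u1 := dp _ _ 1 t fg; have u2 := dp _ _ (-1) t fg.
  have -> : (fun u => f (x + 1 * u) + a * f (x + -1 * u) + (b * u + c * (u * u))) =
      (fun u => f (x + 1 * u)) + a \*: (fun u => f (x + -1 * u))
      + (b \*: id + c \*: (id * id)) by [].
  have di := is_derive_id t (1 : R).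
  have := is_deriveD (is_deriveD u1 (is_deriveZ a u2))
    (is_deriveD (is_deriveZ b di) (is_deriveZ c (is_deriveM di di))).
  by move/is_derive_eq; apply; rewrite /GRing.scale/=; ring.
pose q : R := x * gauss_pdf x.
pose f0 (u : R) : R := Phi (x + 1 * u) + 1 * Phi (x + -1 * u)
  + (0 * u + q * (u * u)) - 2 * Phi x.
pose f1 (u : R) : R := gauss_pdf (x + 1 * u) + -1 * gauss_pdf (x + -1 * u)
  + (2 * q * u + 0 * (u * u)).
pose f2 (u : R) : R := p1 (x + 1 * u) + 1 * p1 (x + -1 * u)
  + (0 * u + 0 * (u * u)) + 2 * q.
pose f3 (u : R) : R := p2 (x + 1 * u) + -1 * p2 (x + -1 * u)
  + (0 * u + 0 * (u * u)).
have D0 (t : R) : 0 <= t -> is_derive t (1 : R) f0 (f1 t).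
  move=> _; have := dsum _ _ 1 0 q t is_derive_Phi.
  move=> /is_deriveB - /(_ _ _ (is_derive_cst (2 * Phi x) t 1)).
  by move/is_derive_eq; apply; rewrite /f1; ring.
have D1 (t : R) : 0 <= t -> is_derive t (1 : R) f1 (f2 t).
  by move=> _; apply: (is_derive_eq (dsum _ _ _ _ _ _ d1)); rewrite /f2; ring.
have D2 (t : R) : 0 <= t -> is_derive t (1 : R) f2 (f3 t).
  move=> _; have := dsum _ _ 1 0 0 t d2.
  move=> /is_deriveB - /(_ _ _ (is_derive_cst (- (2 * q)) t 1)).
  rewrite opprK.
  by move/is_derive_eq; apply; rewrite /f3; ring.
have D3 (t : R) : 0 <= t -> is_derive t (1 : R) f3 (p3 (x + t) + p3 (x - t)).
  by move=> _; apply: (is_derive_eq (dsum _ _ _ _ _ _ d3)); rewrite mul1r mulN1r; ring.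
have B4 (t : R) : 0 <= t -> `|p3 (x + t) + p3 (x - t)| <= 16 * t ^+ 0.
  move=> _; rewrite expr0 mulr1 (le_trans (ler_normD _ _))//.
  have := norm_cubic_gauss_pdf_le8 (x + t).
  by have := norm_cubic_gauss_pdf_le8 (x - t); rewrite /p3; lra.
have K0 : (0 : R) <= 16 by [].
have z3 : f3 0 = 0 by rewrite /f3 !mulr0 addr0; ring.
have z2 : f2 0 = 0 by rewrite /f2 /p1 /q !mulr0 addr0; ring.
have z1 : f1 0 = 0 by rewrite /f1 !mulr0 addr0; ring.
have z0 : f0 0 = 0 by rewrite /f0 !mulr0 addr0; ring.
have B3 := norm_le_of_is_derive D3 z3 K0 B4.
have B2 := norm_le_of_is_derive D2 z2 K0 B3.
have B1 := norm_le_of_is_derive D1 z1 K0 B2.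
have := norm_le_of_is_derive D0 z0 K0 B1 h.
rewrite /f0 !mul1r mulN1r mul0r add0r -expr2 -/q => B /B.
by congr (`|_| <= _); ring.
Qed.

(** * Iterated averaging of the Gaussian distribution function *)

(** [Phi (x * rsqrt1p u)] is the distribution function of variance [1 + u], in a form convenient for
    differentiating in [u]. *)
Definition rsqrt1p {R : realType} (u : R) : R := (Num.sqrt (1 + u))^-1.

Lemma is_derive_rsqrt1p {R : realType} (u : R) : 0 <= u ->
  is_derive u (1 : R) rsqrt1p (- 2^-1 * rsqrt1p u ^+ 3).
Proof.
move=> u0; have u1 : 0 < 1 + u by rewrite ltr_wpDr.
have s0 : Num.sqrt (1 + u) != 0 by rewrite gt_eqF// sqrtr_gt0.
have ds : is_derive u (1 : R) (fun t => Num.sqrt (1 + 1 * t)) ((2 * Num.sqrt (1 + u))^-1 * 1).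
  by apply: is_derive_comp_affine; rewrite mul1r; exact: is_derive1_sqrt.
have -> : rsqrt1p = (fun t : R => (Num.sqrt (1 + 1 * t))^-1).
  by apply: funext => t; rewrite /rsqrt1p mul1r.
apply: is_derive_eq; first by apply: is_deriveV; rewrite mul1r.
by rewrite /rsqrt1p mul1r /GRing.scale/=; field.
Qed.

Lemma rsqrt1p_itv {R : realType} (u : R) : 0 <= u -> 0 < rsqrt1p u <= 1.
Proof.
move=> u0; have u1 : 1 <= 1 + u by rewrite lerDl.
have s0 : 0 < Num.sqrt (1 + u) by rewrite sqrtr_gt0 (lt_le_trans ltr01).
rewrite invr_gt0 s0/= invf_le1// -[leLHS]sqrtr1 ler_sqrt//.
exact: le_trans u1.
Qed.

(** Second order Taylor expansion in [u] at 0: the second derivative is [rsqrt1p u ^+ 4 / 4], at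
    most 1/4, times the cubic expression bounded by 8. *)
Lemma norm_Phi_rsqrt1p_le {R : realType} (x u : R) : 0 <= u ->
  `|Phi (x * rsqrt1p u) - Phi x + x * gauss_pdf x / 2 * u| <= 2 * u ^+ 2.
Proof.
pose q := x * gauss_pdf x / 2.
pose r : R -> R := rsqrt1p.
pose f0 (t : R) := Phi (x * r t) + (- Phi x + q * t).
pose f1 (t : R) := - (x / 2) * (r t ^+ 3 * gauss_pdf (x * r t)) + q.
pose f2 (t : R) :=
  4^-1 * r t ^+ 4 * ((3 * (x * r t) - (x * r t) ^+ 3) * gauss_pdf (x * r t)).
have dr (t : R) : 0 <= t -> is_derive t (1 : R) r (- 2^-1 * r t ^+ 3).
  exact: is_derive_rsqrt1p.
have dc (f : R -> R) (t d : R) : 0 <= t -> is_derive (x * r t) (1 : R) f d ->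
    is_derive t (1 : R) (fun u => f (x * r u)) (d * (x * (- 2^-1 * r t ^+ 3))).
  move=> t0 df; apply: (@is_derive1_comp _ f (x \*: r)) => //.
  exact: (is_deriveZ x (dr _ t0)).
have D0 (t : R) : 0 <= t -> is_derive t (1 : R) f0 (f1 t).
  move=> t0; have dP := dc _ _ _ t0 (is_derive_Phi _).
  have dA := is_derive_affine (- Phi x) q t.
  by apply: (is_derive_eq (is_deriveD dP dA)); rewrite /f1; field.
have D1 (t : R) : 0 <= t -> is_derive t (1 : R) f1 (f2 t).
  move=> t0; have dP := dc _ _ _ t0 (is_derive_gauss_pdf _).
  have d3 := is_deriveX 3 (dr _ t0).
  have dm := is_deriveZ (- (x / 2)) (is_deriveM d3 dP).
  have := is_deriveD dm (is_derive_cst q t 1).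
  by move/is_derive_eq; apply; rewrite /f2 !fctE /GRing.scale/=; field.
have B2 (t : R) : 0 <= t -> `|f2 t| <= 2 * t ^+ 0.
  move=> /rsqrt1p_itv/andP[r0 r1].
  rewrite /f2 normrM expr0 mulr1.
  have -> : (2 : R) = 4^-1 * 1 * 8 by field.
  apply: ler_pM => //; last exact: norm_cubic_gauss_pdf_le8.
  rewrite normrM (ger0_norm (_ : 0 <= 4^-1)) ?invr_ge0// ler_wpM2l ?invr_ge0//.
  by rewrite normrX ger0_norm ?exprn_ile1// ltW.
have r0 : r 0 = 1 by rewrite /r /rsqrt1p addr0 sqrtr1 invr1.
have K0 : (0 : R) <= 2 by [].
have z1 : f1 0 = 0 by rewrite /f1 /q r0 mulr1; field.
have z0 : f0 0 = 0 by rewrite /f0 r0 mulr1; ring.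
have B1 := norm_le_of_is_derive D1 z1 K0 B2.
move=> u0; have := norm_le_of_is_derive D0 z0 K0 B1 _ u0.
by rewrite /f0 addrA.
Qed.

Definition rademacher_step {R : realType} (h : R) (f : R -> R) (x : R) : R :=
  (f (x + h) + f (x - h)) / 2.

Definition Phi_var {R : realType} (s x : R) : R := Phi (x / Num.sqrt s).

(** A discrete heat equation: averaging and increasing the variance by [h^2] both change [Phi x] by
    [- x * gauss_pdf x * h^2 / 2] to leading order. The remainders contribute 16/2 and 2. *)
Lemma rademacher_step_Phi {R : realType} (h x : R) : 0 <= h ->
  `|rademacher_step h Phi x - Phi (x * rsqrt1p (h ^+ 2))| <= 10 * h ^+ 4.
Proof.
move=> h0; have := norm_second_difference_Phi_le x h h0.
have := norm_Phi_rsqrt1p_le x _ (sqr_ge0 h); rewrite -exprM /rademacher_step.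
set a := Phi _; set b := Phi _ ; set c := Phi (x + h); set d := Phi (x - h).
set e := x * gauss_pdf x; set k := h ^+ 2.
by rewrite !ler_norml => /andP[? ?] /andP[? ?]; apply/andP; split; lra.
Qed.

Lemma rademacher_step_Phi_var {R : realType} (h s x : R) : 0 <= h -> 0 < s ->
  `|rademacher_step h (Phi_var s) x - Phi_var (s + h ^+ 2) x| <= 10 * h ^+ 4 / s ^+ 2.
Proof.
move=> h0 s0; have r0 : 0 < Num.sqrt s by rewrite sqrtr_gt0.
have := @rademacher_step_Phi R (h / Num.sqrt s) (x / Num.sqrt s) (divr_ge0 h0 (ltW r0)).
rewrite /rademacher_step /Phi_var /rsqrt1p -!mulrDl -mulrBl.
rewrite !expr_div_n (exprM (Num.sqrt s) 2 2) sqr_sqrtr ?(ltW s0)//.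
rewrite -[x / _ / _]mulrA -invfM -sqrtrM ?(ltW s0)//.
have -> : s * (1 + h ^+ 2 / s) = s + h ^+ 2 by field; rewrite gt_eqF.
by rewrite mulrA.
Qed.

(** Averaging is linear, positive and fixes constants, so it contracts the sup norm. Hence the error
    of one step is not amplified by the later ones. *)
Lemma iter_rademacher_step_contract {R : realType} (h e : R) (f g : R -> R) n x :
  (forall y, `|f y - g y| <= e) ->
  `|iter n (rademacher_step h) f x - iter n (rademacher_step h) g x| <= e.
Proof.
move=> fg; elim: n x => // n IHn x; rewrite !iterS {1 3}/rademacher_step.
have := IHn (x + h); have := IHn (x - h).
set a := iter _ _ _ _; set b := iter _ _ _ _; set c := iter _ _ _ _.
set d := iter _ _ _ _.
by rewrite !ler_norml => /andP[? ?] /andP[? ?]; apply/andP; split; lra.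
Qed.

(* The one-step error telescopes against the potential [20 h^2 / s]. *)
Lemma iter_rademacher_step_Phi_var {R : realType} (h s : R) n x :
  0 <= h -> 0 < s -> h ^+ 2 <= s ->
  `|iter n (rademacher_step h) (Phi_var s) x - Phi_var (s + n%:R * h ^+ 2) x|
    <= 20 * h ^+ 2 / s - 20 * h ^+ 2 / (s + n%:R * h ^+ 2).
Proof.
move=> h0; elim: n s x => [|n IHn] s x s0 hs.
  by rewrite mul0r addr0 !subrr normr0.
have h2 := sqr_ge0 h.
rewrite iterSr.
have hs1 : 0 < s + h ^+ 2 by lra.
have hs2 : h ^+ 2 <= s + h ^+ 2 by lra.
have := IHn _ x hs1 hs2.
have -> : s + h ^+ 2 + n%:R * h ^+ 2 = s + n.+1%:R * h ^+ 2 by rewrite -natr1; ring.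
have := iter_rademacher_step_contract h _ _ _ n x
  (fun y => rademacher_step_Phi_var h s y h0 s0).
set a := iter _ _ _ _; set b := iter _ _ _ _; set c := Phi_var _ _.
(* The drop of the potential equals [20 h^4 / (s (s + h^2))], and [h^2 <= s] gives [s + h^2 <= 2 s];
   hence 20 is twice the constant 10. *)
have step : 10 * h ^+ 4 / s ^+ 2 <= 20 * h ^+ 2 / s - 20 * h ^+ 2 / (s + h ^+ 2).
  have -> : 20 * h ^+ 2 / s - 20 * h ^+ 2 / (s + h ^+ 2) =
      20 * h ^+ 4 / (s * (s + h ^+ 2)).
    by field; rewrite !gt_eqF.
  rewrite ler_pdivrMr ?exprn_gt0// mulrAC ler_pdivlMr ?mulr_gt0//.
  have -> : 20 * h ^+ 4 * s ^+ 2 = 10 * h ^+ 4 * (s * (s + s)) by ring.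
  rewrite ler_wpM2l ?mulr_ge0 ?exprn_ge0// ler_wpM2l ?(ltW s0)//; lra.
rewrite !ler_norml => /andP[? ?] /andP[? ?]; apply/andP; split; lra.
Qed.

(** * Uniform random signs *)

Definition uexp {R : realType} {I : finType} (F : {ffun I -> bool} -> R) : R :=
  (\sum_b F b) / 2 ^+ #|I|.

Definition rademacher {R : realType} {I : finType} (b : {ffun I -> bool}) (i : I) : R :=
  if b i then 1 else -1.

Definition flip {I : finType} (i : I) (b : {ffun I -> bool}) : {ffun I -> bool} :=
  [ffun j => (j == i) (+) b j].

(** These are the Walsh functions, that is, the characters of the group of sign vectors. *)
Definition character {R : realType} {I : finType} (A : {set I})
    (b : {ffun I -> bool}) : R :=
  \prod_(i in A) rademacher b i.

Section uniform_expectation.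
Context {R : realType} {I : finType}.
Implicit Types (F G : {ffun I -> bool} -> R) (i : I) (A B : {set I}).
Implicit Types (b : {ffun I -> bool}).

Lemma uexpD F G : uexp (fun b => F b + G b) = uexp F + uexp G.
Proof. by rewrite /uexp big_split/= mulrDl. Qed.

Lemma uexpZ c F : uexp (fun b => c * F b) = c * uexp F.
Proof. by rewrite /uexp -mulr_sumr mulrA. Qed.

Lemma uexp_cst (c : R) : uexp (fun _ : {ffun I -> bool} => c) = c.
Proof.
by rewrite /uexp sumr_const card_ffun card_bool -[c *+ _]mulr_natr natrX mulfK.
Qed.

Lemma uexp_sum (J : finType) (P : pred J) (F : J -> {ffun I -> bool} -> R) :
  uexp (fun b => \sum_(j | P j) F j b) = \sum_(j | P j) uexp (F j).
Proof. by rewrite /uexp exchange_big/= mulr_suml. Qed.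

Lemma ler_uexp F G : (forall b, F b <= G b) -> uexp F <= uexp G.
Proof. by move=> FG; rewrite ler_wpM2r ?invr_ge0 ?exprn_ge0// ler_sum. Qed.

Lemma eq_uexp F G : (forall b, F b = G b) -> uexp F = uexp G.
Proof. by move=> FG; rewrite /uexp (eq_bigr _ (fun b _ => FG b)). Qed.

Lemma flipK i : involutive (flip i).
Proof. by move=> b; apply/ffunP => j; rewrite !ffunE addbA addbb. Qed.

Lemma uexp_flip i F : uexp (fun b => F (flip i b)) = uexp F.
Proof. by rewrite /uexp [in RHS](reindex_inj (inv_inj (flipK i))). Qed.

Lemma rademacher_flip i j b :
  rademacher (flip i b) j = (if j == i then - rademacher b j else rademacher b j) :> R.
Proof.
rewrite /rademacher ffunE; case: eqP => //= _; case: (b j) => //=.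
by rewrite opprK.
Qed.

Lemma rademacher_sqr b i : rademacher b i ^+ 2 = 1 :> R.
Proof. by rewrite /rademacher; case: (b i); rewrite ?sqrrN expr1n. Qed.

Lemma character_flip i A b :
  character A (flip i b) = (if i \in A then - character A b else character A b) :> R.
Proof.
rewrite /character; case: ifPn => iA.
  rewrite (bigD1 i)//= [in RHS](bigD1 i)//= rademacher_flip eqxx mulNr; congr (- (_ * _)).
  by apply: eq_bigr => j /andP[_ /negbTE ji]; rewrite rademacher_flip ji.
apply: eq_bigr => j jA; rewrite rademacher_flip; case: eqP => // ji.
by rewrite -ji jA in iA.
Qed.

(** If [A] and [B] differ at [i], flipping the sign at [i] negates the product but preserves the
    uniform law, so the expectation equals its own opposite. *)
Lemma uexp_character A B : uexp (fun b => character A b * character B b) = (A == B)%:R :> R.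
Proof.
have [->|/eqP AB] := eqVneq A B.
  rewrite (@eq_uexp _ (fun=> 1)) ?uexp_cst// => b.
  rewrite -big_split/= big1// => i _; rewrite -expr2; exact: rademacher_sqr.
have [i iAB] : exists i, (i \in A) != (i \in B).
  apply: contrapT => /forallNP AB'; apply: AB; apply/setP => i.
  by have /negP := AB' i; rewrite negbK => /eqP.
rewrite mulr0n; suff : uexp (fun b => character A b * character B b) =
       - uexp (fun b => character A b * character B b) :> R by lra.
rewrite -[LHS](uexp_flip i) -mulN1r -uexpZ; apply: eq_uexp => b.
rewrite !character_flip; move: iAB.
by case: (i \in A); case: (i \in B) => //= _; rewrite mulN1r ?mulNr ?mulrN.
Qed.

Lemma uexp_character_sum_sqr (J : finType) (P : pred J) (D : J -> {set I}) :
  uexp (fun b => (\sum_(p | P p) character (D p) b) ^+ 2) =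
  \sum_(p | P p) \sum_(q | P q) (D p == D q)%:R :> R.
Proof.
rewrite (@eq_uexp _ (fun b =>
  \sum_(p | P p) \sum_(q | P q) character (D p) b * character (D q) b)).
  rewrite uexp_sum; apply: eq_bigr => p _; rewrite uexp_sum; apply: eq_bigr => q _.
  exact: uexp_character.
move=> b; rewrite expr2 mulr_suml; apply: eq_bigr => p _; exact: mulr_sumr.
Qed.

(** Averaging over the first sign produces one [rademacher_step]. As [s] has no repetition, flipping
    that sign leaves the rest of the sum unchanged. *)
Lemma uexp_walk (h x : R) (f : R -> R) (s : seq I) : uniq s ->
  uexp (fun b => f (x + h * \sum_(i <- s) rademacher b i)) =
  iter (size s) (rademacher_step h) f x.
Proof.
elim: s f => [|i s IHs] f /=.
  by move=> _; rewrite -[RHS]uexp_cst; apply: eq_uexp => b; rewrite big_nil mulr0 addr0.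
move=> /andP[iNs us]; rewrite -iterS iterSr -IHs//.
set F := (fun b => f _).
have -> : uexp F = uexp (fun b => 2^-1 * (F b + F (flip i b))).
  by rewrite uexpZ uexpD uexp_flip; field.
apply: eq_uexp => b; rewrite /F !big_cons /rademacher_step mulrC; congr (_ / 2).
rewrite rademacher_flip eqxx.
have -> : \sum_(j <- s) rademacher (flip i b) j = \sum_(j <- s) rademacher b j :> R.
  apply: eq_big_seq => j js; rewrite rademacher_flip; case: eqP => // ji.
  by rewrite -ji js in iNs.
set t := \sum_(_ <- _) _; rewrite /rademacher; case: (b i).
  by congr (f _ + f _); ring.
by rewrite addrC; congr (f _ + f _); ring.
Qed.

Definition walk b : R := \sum_i rademacher b i.

Lemma uexp_walkT (h x : R) (f : R -> R) :
  uexp (fun b => f (x + h * walk b)) = iter #|I| (rademacher_step h) f x.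
Proof.
rewrite cardT -uexp_walk ?enum_uniq//.
by apply: eq_uexp => b; rewrite big_enum.
Qed.

(** The moments of the walk are the values at [x = 0]; a general starting point is what makes the
    induction close. *)
Lemma iter_rademacher_step_moments n (x : R) :
  [/\ iter n (rademacher_step 1) id x = x,
      iter n (rademacher_step 1) (fun t => t ^+ 2) x = x ^+ 2 + n%:R,
      iter n (rademacher_step 1) (fun t => t ^+ 3) x = x ^+ 3 + 3 * n%:R * x &
      iter n (rademacher_step 1) (fun t => t ^+ 4) x =
        x ^+ 4 + 6 * n%:R * x ^+ 2 + 3 * n%:R ^+ 2 - 2 * n%:R].
Proof.
elim: n x => [|n IHn] x /=; first by split; ring.
have [a1 a2 a3 a4] := IHn (x + 1); have [b1 b2 b3 b4] := IHn (x - 1).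
rewrite {1 3 5 7}/rademacher_step a1 a2 a3 a4 b1 b2 b3 b4 -natr1.
by split; field.
Qed.

Lemma uexp_walk_moments :
  [/\ uexp walk = 0,
      uexp (fun b => walk b ^+ 2) = #|I|%:R,
      uexp (fun b => walk b ^+ 3) = 0 &
      uexp (fun b => walk b ^+ 4) = 3 * #|I|%:R ^+ 2 - 2 * #|I|%:R].
Proof.
have [e1 e2 e3 e4] := iter_rademacher_step_moments #|I| 0.
have W f : uexp (fun b => f (walk b)) = iter #|I| (rademacher_step 1) f 0.
  by rewrite -uexp_walkT; apply: eq_uexp => b; rewrite add0r mul1r.
split; [rewrite (W id) e1|rewrite (W (fun t => t ^+ 2)) e2|
  rewrite (W (fun t => t ^+ 3)) e3|rewrite (W (fun t => t ^+ 4)) e4] => //; ring.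
Qed.

End uniform_expectation.

(** * Expansion of the number of progressions *)

Section progressions.
Context {R : realType} {V : finZmodType}.
(** Without 2-torsion, doubling permutes the finite group and the three terms of a progression with
    nonzero step are distinct. *)
Hypothesis V2 : forall j : V, j *+ 2 = 0 -> j = 0.
Implicit Types (i j : V) (e : V -> R) (b : {ffun V -> bool}).

Let N : R := #|V|%:R.

Lemma double_inj : injective (fun j : V => j *+ 2).
Proof.
move=> j k /eqP; rewrite -subr_eq0 -mulrnBl => /eqP/V2/eqP.
by rewrite subr_eq0 => /eqP.
Qed.

Lemma sum_shift e i : \sum_j e (i + j) = \sum_j e j.
Proof. by rewrite [RHS](reindex_inj (addrI i)). Qed.

Lemma sum_shift_double e i : \sum_j e (i + j *+ 2) = \sum_j e j.
Proof.
rewrite -(sum_shift e i) [RHS](reindex_inj double_inj).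
by apply: eq_bigr.
Qed.

Definition triple_sum e : R :=
  \sum_i \sum_(j | j != 0) e i * e (i + j) * e (i + j *+ 2).

Lemma progression_expansion e : (forall i, e i ^+ 2 = 1) ->
  let y i := (1 + e i) / 2 in let S := \sum_i e i in
  2^-1 * (\sum_i \sum_(j | j != 0) y i * y (i + j) * y (i + j *+ 2)) =
  16^-1 * (N * (N - 1) + 3 * (N - 1) * S + (3 * (S ^+ 2 - N) + triple_sum e)).
Proof.
move=> e2 y S.
(* All monomials of the product except the cubic one. Their sums factor once [j] ranges over the
   whole group; the terms with [j = 0] are subtracted afterwards. *)
pose g i j : R := 1 + e i + e (i + j) + e (i + j *+ 2) + e i * e (i + j)
  + e i * e (i + j *+ 2) + e (i + j) * e (i + j *+ 2).
have gE : \sum_i \sum_j g i j = N ^+ 2 + 3 * N * S + 3 * S ^+ 2.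
  have c1 (c : R) : \sum_(i : V) c = N * c by rewrite sumr_const -mulr_natl.
  have s1 : \sum_i \sum_(j : V) e i = N * S.
    by rewrite mulr_sumr; apply: eq_bigr => i _; rewrite c1.
  have s2 : \sum_i \sum_j e (i + j) = N * S.
    by under eq_bigr do rewrite sum_shift; rewrite c1.
  have s3 : \sum_i \sum_j e (i + j *+ 2) = N * S.
    by under eq_bigr do rewrite sum_shift_double; rewrite c1.
  have s4 : \sum_i \sum_j e i * e (i + j) = S ^+ 2.
    rewrite expr2 mulr_suml; apply: eq_bigr => i _.
    by rewrite -mulr_sumr sum_shift.
  have s5 : \sum_i \sum_j e i * e (i + j *+ 2) = S ^+ 2.
    rewrite expr2 mulr_suml; apply: eq_bigr => i _.
    by rewrite -mulr_sumr sum_shift_double.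
  have s6 : \sum_i \sum_j e (i + j) * e (i + j *+ 2) = S ^+ 2.
    rewrite -s4 exchange_big [RHS]exchange_big; apply: eq_bigr => j _ /=.
    rewrite [RHS](reindex_inj (addIr j)); apply: eq_bigr => i _ /=.
    by rewrite mulr2n addrA.
  have s0 : \sum_(i : V) \sum_(j : V) 1 = N ^+ 2 :> R by rewrite !c1 mulr1.
  under eq_bigr do rewrite !big_split /=.
  by rewrite !big_split/= s0 s1 s2 s3 s4 s5 s6; ring.
(* At [j = 0] the three quadratic monomials become squares of signs, so
   [g i 0 = 1 + 3 * e i + 3]. *)
have g0 : \sum_i g i 0 = 4 * N + 3 * S.
  have -> : 4 * N + 3 * S = \sum_i (4 + 3 * e i).
    by rewrite big_split/= -mulr_sumr sumr_const -/N mulr_natr.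
  apply: eq_bigr => i _; rewrite /g mul0rn addr0 -!expr2 e2; ring.
have -> : \sum_i \sum_(j | j != 0) y i * y (i + j) * y (i + j *+ 2) =
    8^-1 * (\sum_i \sum_j g i j - \sum_i g i 0 + triple_sum e).
  rewrite /triple_sum -sumrB -big_split mulr_sumr; apply: eq_bigr => i _ /=.
  have -> : \sum_j g i j = \sum_(j | j != 0) g i j + g i 0.
    by rewrite (bigD1 0)//= addrC.
  rewrite addrK -big_split/= mulr_sumr.
  by apply: eq_bigr => j _; rewrite /y /g; field.
by rewrite gE g0; field.
Qed.

Definition progression i j : {set V} := [set i; i + j; i + j *+ 2].

Lemma progression_uniq i j : j != 0 -> uniq [:: i; i + j; i + j *+ 2].
Proof.
move=> j0; have j2 : j *+ 2 != 0 by apply: contra j0 => /eqP/V2/eqP.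
have addE (a c : V) : (a == a + c) = (0 == c).
  by rewrite -[X in X == _]addr0 (inj_eq (addrI a)).
rewrite /= !inE negb_or !addE (inj_eq (addrI i)) mulr2n addE -mulr2n.
by rewrite !(eq_sym 0) j0 j2.
Qed.

Lemma character_progression i j b : j != 0 ->
  character (progression i j) b =
  rademacher b i * rademacher b (i + j) * rademacher b (i + j *+ 2) :> R.
Proof.
move=> /(progression_uniq i) u.
have -> : progression i j = [set x in [:: i; i + j; i + j *+ 2]]%SET.
  by apply/setP => x; rewrite !inE orbA.
rewrite /character (eq_bigl (mem [:: i; i + j; i + j *+ 2])) => [|x]; last by rewrite !inE.
by rewrite -big_uniq//= !big_cons big_nil mulr1 mulrA.
Qed.

Lemma card_progression i j : j != 0 -> #|progression i j| = 3%N.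
Proof.
move=> /(progression_uniq i)/card_uniqP/= <-.
by apply: eq_card => x; rewrite !inE orbA.
Qed.

Lemma triple_sum_rademacher b :
  triple_sum (rademacher b) =
  \sum_(p : V * V | p.2 != 0) character (progression p.1 p.2) b.
Proof.
rewrite /triple_sum pair_big_dep/=; apply: eq_bigr => -[i j] /= j0.
by rewrite character_progression.
Qed.

(** Orthogonality of characters, since progressions have three elements. The empty set gives mean
    zero, and singletons give orthogonality to the walk. *)
Lemma uexp_character_triple_sum (A : {set V}) : #|A| != 3%N ->
  uexp (fun b => character A b * triple_sum (rademacher b)) = 0 :> R.
Proof.
move=> A3.
rewrite (@eq_uexp _ _ _ (fun b => \sum_(p : V * V | p.2 != 0)
    character A b * character (progression p.1 p.2) b)); last first.
  by move=> b; rewrite triple_sum_rademacher mulr_sumr.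
rewrite uexp_sum big1// => p p0; rewrite uexp_character.
by case: eqP => // Ap; rewrite Ap card_progression in A3.
Qed.

(* A progression is determined by its first two terms, so at most nine of them
   have a given underlying set. *)
Lemma uexp_triple_sum_sqr :
  uexp (fun b => triple_sum (rademacher b) ^+ 2) <= 9 * N ^+ 2.
Proof.
under eq_uexp do rewrite triple_sum_rademacher.
rewrite uexp_character_sum_sqr.
have nine (p : V * V) : p.2 != 0 ->
    \sum_(q : V * V | q.2 != 0) (progression p.1 p.2 == progression q.1 q.2)%:R <= 9 :> R.
  move=> p0; set A := progression _ _.
  rewrite -natr_sum ler_nat.
  apply: (@leq_trans #|[set q : V * V | (q.1 \in A) && (q.1 + q.2 \in A)]%SET|).
    rewrite -sum1dep_card big_mkcond [X in (_ <= X)%N]big_mkcond; apply: leq_sum => -[i j] _.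
    case: ifP => // j0 /=; case: eqP => //= ->.
    by rewrite !inE !eqxx !orbT.
  have f_inj : injective (fun q : V * V => (q.1, q.1 + q.2)).
    by move=> [i j] [k l] [-> /addrI ->].
  rewrite -(card_imset _ f_inj).
  apply: (@leq_trans #|finset.setX A A|).
    apply: subset_leq_card; apply/fintype.subsetP => _ /imsetP[q + ->].
    by rewrite !inE.
  by rewrite cardsX card_progression.
apply: (@le_trans _ _ (\sum_(p : V * V | p.2 != 0) 9)); first exact: ler_sum.
rewrite big_mkcond.
apply: (@le_trans _ _ (\sum_(p : V * V) 9)).
  by apply: ler_sum => p _; case: ifP.
by rewrite sumr_const card_prod -[leLHS]mulr_natr natrM -expr2.
Qed.

Definition remainder b : R := 3 * (walk b ^+ 2 - N) + triple_sum (rademacher b).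

Lemma uexp_remainder : uexp remainder = 0.
Proof.
have [_ m2 _ _] := @uexp_walk_moments R V.
have t0 : uexp (fun b => triple_sum (rademacher b)) = 0 :> R.
  rewrite -(@uexp_character_triple_sum finset.set0) ?cards0//.
  by apply: eq_uexp => b; rewrite /character big_set0 mul1r.
by rewrite /remainder uexpD uexpZ uexpD uexp_cst m2 t0 addr0 subrr mulr0.
Qed.

(** The first and third moments of the walk vanish, and the walk is a sum of singleton characters.
    This makes the variance of [centered] exactly additive. *)
Lemma uexp_walk_remainder : uexp (fun b => walk b * remainder b) = 0.
Proof.
have [m1 _ m3 _] := @uexp_walk_moments R V.
have t0 : uexp (fun b => walk b * triple_sum (rademacher b)) = 0 :> R.
  rewrite (@eq_uexp _ _ _ (fun b =>
    \sum_i character [set i]%SET b * triple_sum (rademacher b))).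
    by rewrite uexp_sum big1// => i _; rewrite uexp_character_triple_sum ?cards1.
  move=> b; rewrite /walk mulr_suml; apply: eq_bigr => i _.
  by rewrite /character big_set1.
have -> : uexp (fun b => walk b * remainder b) = uexp (fun b =>
    3 * walk b ^+ 3 + ((- 3 * N) * walk b + walk b * triple_sum (rademacher b))).
  by apply: eq_uexp => b; rewrite /remainder; ring.
by rewrite !uexpD !uexpZ m1 m3 t0; ring.
Qed.

(** From [(a + b)^2 <= 2 a^2 + 2 b^2]: the walk contributes [18 (2 N^2 - 2 N)] and the triple sum at
    most [18 N^2]. *)
Lemma uexp_remainder_sqr : uexp (fun b => remainder b ^+ 2) <= 54 * N ^+ 2.
Proof.
have [_ m2 _ m4] := @uexp_walk_moments R V.
apply: (@le_trans _ _ (uexp (fun b => 18 * walk b ^+ 4 + (- 36 * N * walk b ^+ 2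
    + (18 * N ^+ 2 + 2 * triple_sum (rademacher b) ^+ 2))))).
  apply: ler_uexp => b; rewrite /remainder -subr_ge0.
  have := sqr_ge0 (3 * (walk b ^+ 2 - N) - triple_sum (rademacher b)).
  by congr (_ <= _); ring.
rewrite !uexpD !uexpZ uexp_cst m2 m4.
have := uexp_triple_sum_sqr; rewrite -/N; have : 0 <= N by [].
by set u := uexp _; lra.
Qed.

End progressions.

(** * Smoothing *)

Section smoothing.
Context {R : realType} {I : finType}.
Implicit Types (X Q : {ffun I -> bool} -> R).

(** The bound is pointwise. On the event, either [X <= z + t], and the smoothed indicator is at
    least [Phi K], or [Q < - t], and [Q^2 / t^2] exceeds 1. *)
Lemma uexp_smoothing_upper X Q (z d K t : R) :
  0 < d -> 0 < K -> 0 < t ->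
  uexp (fun b => (X b + Q b <= z)%R%:R) <=
  uexp (fun b => Phi ((z + t + K * d - X b) / d)) + 2 / K ^+ 2
    + uexp (fun b => Q b ^+ 2) / t ^+ 2.
Proof.
move=> d0 K0 t0.
rewrite -[2 / _](@uexp_cst R I) [_ / t ^+ 2]mulrC -uexpZ -!uexpD; apply: ler_uexp => b.
have P0 := Phi_ge0 ((z + t + K * d - X b) / d).
have K2 : 0 < 2 / K ^+ 2 by rewrite divr_gt0 ?exprn_gt0.
have Q2 : 0 <= (t ^+ 2)^-1 * Q b ^+ 2 by rewrite mulr_ge0 ?invr_ge0 ?sqr_ge0.
case: (leP (X b + Q b) z) => [XQ|_] /=; last by lra.
have [Xz|Xz] := leP (X b) (z + t).
  have PK : Phi K <= Phi ((z + t + K * d - X b) / d).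
    by apply: Phi_homo; rewrite ler_pdivlMr//; lra.
  by have := Phi_upper_tail K K0; lra.
suff : 1 <= (t ^+ 2)^-1 * Q b ^+ 2 by lra.
rewrite mulrC ler_pdivlMr ?exprn_gt0// mul1r -[leRHS]sqrrN lerXn2r ?nnegrE//; lra.
Qed.

(** Mirror image on the complementary event: either [X >= z - t], and the smoothed indicator is at
    most [Phi (- K)], or [Q > t]. *)
Lemma uexp_smoothing_lower X Q (z d K t : R) :
  0 < d -> 0 < K -> 0 < t ->
  uexp (fun b => Phi ((z - t - K * d - X b) / d)) - 2 / K ^+ 2
    - uexp (fun b => Q b ^+ 2) / t ^+ 2 <=
  uexp (fun b => (X b + Q b <= z)%R%:R).
Proof.
move=> d0 K0 t0.
rewrite !lerBlDr -[2 / _](@uexp_cst R I) [_ / t ^+ 2]mulrC -uexpZ -!uexpD; apply: ler_uexp => b.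
have P1 := Phi_le1 ((z - t - K * d - X b) / d).
have K2 : 0 < 2 / K ^+ 2 by rewrite divr_gt0 ?exprn_gt0.
have Q2 : 0 <= (t ^+ 2)^-1 * Q b ^+ 2 by rewrite mulr_ge0 ?invr_ge0 ?sqr_ge0.
case: (leP (X b + Q b) z) => [_|XQ] /=; first by lra.
have [Xz|Xz] := leP (z - t) (X b).
  have PK : Phi ((z - t - K * d - X b) / d) <= Phi (- K).
    by apply: Phi_homo; rewrite ler_pdivrMr//; lra.
  by have := Phi_lower_tail K K0; lra.
suff : 1 <= (t ^+ 2)^-1 * Q b ^+ 2 by lra.
rewrite mulrC ler_pdivlMr ?exprn_gt0// mul1r lerXn2r ?nnegrE//; lra.
Qed.

(** Starting from variance [d^2], the walk adds total variance 1. Passing from variance [d^2 + 1]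
    back to 1 is a dilation by at most [1 + d^2], which costs the last term. *)
Lemma uexp_Phi_walk (h d x : R) : 0 < h -> h <= d ->
  h ^+ 2 * #|I|%:R = 1 ->
  `|uexp (fun b : {ffun I -> bool} => Phi ((x - h * walk b) / d)) - Phi x|
    <= 20 * h ^+ 2 / d ^+ 2 + d ^+ 2.
Proof.
move=> h0 hd hn; have d0 : 0 < d by lra.
have d2 : 0 < d ^+ 2 by rewrite exprn_gt0.
have hd2 : h ^+ 2 <= d ^+ 2 by rewrite lerXn2r// nnegrE ltW.
have := @iter_rademacher_step_Phi_var R h (d ^+ 2) #|I| x (ltW h0) d2 hd2.
have -> : #|I|%:R * h ^+ 2 = 1 by rewrite mulrC.
(* The step is even in [h], which reconciles [x - h * walk b] with the sign convention of
   [uexp_walkT]. *)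
have sE : rademacher_step h = rademacher_step (- h) :> ((R -> R) -> R -> R).
  by apply: funext => f; apply: funext => y; rewrite /rademacher_step opprK addrC.
rewrite sE -uexp_walkT.
have sd : Num.sqrt (d ^+ 2) = d by rewrite sqrtr_sqr ger0_norm// ltW.
have -> : uexp (fun b : {ffun I -> bool} => Phi_var (d ^+ 2) (x + - h * walk b)) =
    uexp (fun b : {ffun I -> bool} => Phi ((x - h * walk b) / d)).
  by apply: eq_uexp => b; rewrite /Phi_var sd mulNr.
set r := Num.sqrt (d ^+ 2 + 1).
have rge1 : 1 <= r by rewrite -[leLHS]sqrtr1 ler_sqrt; lra.
have rle : r <= 1 + d ^+ 2.
  rewrite -[leRHS]ger0_norm; last lra.
  rewrite -sqrtr_sqr ler_sqrt; last by rewrite sqr_ge0.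
  by have := sqr_ge0 (d ^+ 2); rewrite sqrrD; lra.
have := Phi_dilate (x / r) r rge1; rewrite mulrC divfK; last by rewrite gt_eqF//; lra.
have -> : Phi (x / r) = Phi_var (d ^+ 2 + 1) x by [].
have : 0 <= 20 * h ^+ 2 / (d ^+ 2 + 1).
  by rewrite divr_ge0 ?mulr_ge0 ?sqr_ge0//; lra.
set u := uexp _; set v := Phi_var _ _; set w := Phi x => a0.
by rewrite !ler_norml => /andP[? ?] /andP[? ?]; apply/andP; split; lra.
Qed.

End smoothing.

(** * Reduction to uniform random signs *)

Section transfer.
Context {d : measure_display} {T : measurableType d} {R : realType}.
Context {P : probability T R} {I : finType} {x : I -> {RV P >-> R}}.
Hypothesis x_indep : mutually_independent x.
Hypothesis x_bern : forall i, bernoulli_half (x i).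

(** The intersection is written over the full index set in the shape used by [mutually_independent],
    so that the product rule applies directly. *)
Definition cylinder (b : {ffun I -> bool}) : set T :=
  \bigcap_(i in [set i | i \in [set: I]%SET]) (x i @^-1` [set (b i)%:R]).

Lemma measurable_cylinder b : measurable (cylinder b).
Proof.
by apply: fin_bigcap_measurable.
Qed.

Lemma probability_cylinder b : P (cylinder b) = ((2 ^+ #|I|)^-1)%:E.
Proof.
rewrite /cylinder (x_indep [set: I]%SET (fun i => [set (b i)%:R])); last first.
  by move=> i _; exact: measurable_set1.
rewrite (eq_bigr (fun=> (2^-1)%:E)) => [|i _]; last first.
  by have [h1 h0] := x_bern i; case: (b i).
by rewrite prodEFin prodr_const cardsT exprVn.
Qed.

Lemma trivIset_cylinder : trivIset setT cylinder.
Proof.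
move=> b c _ _ [t [tb tc]]; apply/ffunP => i.
have /= := tb i; rewrite inE => /(_ isT) eb.
have /= := tc i; rewrite inE => /(_ isT); rewrite eb => /eqP.
by rewrite eqr_nat; case: (b i); case: (c i).
Qed.

Let U := \big[setU/set0]_(b <- enum {ffun I -> bool}) cylinder b.

Let integral_U (Y : T -> R) (F : {ffun I -> bool} -> R) :
  measurable_fun setT Y -> (forall b t, cylinder b t -> Y t = F b) ->
  (\int[P]_(t in U) (Y t)%:E = (uexp F)%:E)%E.
Proof.
move=> mY YF; rewrite integral_bigsetU_EFin//; last 4 first.
- exact: measurable_cylinder.
- exact: enum_uniq.
- exact: sub_trivIset trivIset_cylinder.
- by apply: measurable_funTS; exact/measurable_EFinP.
rewrite big_enum/= /uexp mulr_suml -sumEFin; apply: eq_bigr => b _.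
rewrite (eq_integral (fun=> (F b)%:E)) => [|t]; last by rewrite inE => /YF ->.
rewrite integral_cst; last exact: measurable_cylinder.
by rewrite EFinM; congr (_ * _)%E; exact: probability_cylinder.
Qed.

Let measurable_U : measurable U.
Proof. by apply: bigsetU_measurable => b _; exact: measurable_cylinder. Qed.

Let probability_U : P U = 1%E.
Proof.
(* The total mass of the cylinders is the integral of the constant 1 over [U], which is the uniform
   expectation of 1. *)
have := integral_U (cst 1) (fun=> 1) (measurable_cst _) (fun _ _ _ => erefl).
rewrite uexp_cst (_ : \int[P]_(t in U) _ = \int[P]_(t in U) (cst 1%E) t)%E//.
by rewrite integral_cst// mul1e.
Qed.

(** The variables need take the values 0 and 1 only almost surely, so the cylinders cover the space
    only up to a null set; the integral does not see the rest. *)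
Lemma integral_uexp (Y : T -> R) (F : {ffun I -> bool} -> R) :
  measurable_fun setT Y -> (forall b t, cylinder b t -> Y t = F b) ->
  (\int[P]_t (Y t)%:E = (uexp F)%:E)%E.
Proof.
move=> mY YF; rewrite -(integral_U _ _ mY YF) [RHS]integral_mkcond.
have mEY : measurable_fun setT (EFin \o Y) by exact/measurable_EFinP.
apply: ae_eq_integral => //.
  by apply/(measurable_restrictT _ measurable_U); exact: measurable_funTS.
exists (~` U); split; first exact: measurableC.
  by have : P (~` U) = 0%E by rewrite probability_setC// probability_U subee.
move=> t /= /not_implyP[_ +]; apply: contra_not => Ut.
by rewrite patchE mem_set.
Qed.

End transfer.

(** * The normal approximation *)

Section rademacher_berry_esseen.
Context {R : realType} {V : finZmodType}.
Hypothesis V2 : forall j : V, j *+ 2 = 0 -> j = 0.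
Hypothesis V_gt1 : (1 < #|V|)%N.

Let N : R := #|V|%:R.

Definition centered (b : {ffun V -> bool}) : R :=
  (3 * (N - 1) * walk b + remainder b) / 16.

Lemma uexp_centered : uexp centered = 0.
Proof.
have [m1 _ _ _] := @uexp_walk_moments R V.
rewrite (@eq_uexp _ _ _ (fun b => 16^-1 * (3 * (N - 1) * walk b + remainder b))).
  by rewrite uexpZ uexpD uexpZ m1 uexp_remainder// !(mulr0, addr0).
by move=> b; rewrite mulrC.
Qed.

Lemma uexp_centered_sqr : uexp (fun b => centered b ^+ 2) =
  (9 * (N - 1) ^+ 2 * N + uexp (fun b : {ffun V -> bool} => (remainder b : R) ^+ 2)) / 256.
Proof.
have [_ m2 _ _] := @uexp_walk_moments R V.
have wr := @uexp_walk_remainder R V V2.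
rewrite (@eq_uexp _ _ _ (fun b => 256^-1 * (9 * (N - 1) ^+ 2 * walk b ^+ 2 +
    (6 * (N - 1) * (walk b * remainder b) + remainder b ^+ 2)))).
  by rewrite uexpZ !uexpD !uexpZ m2 wr mulr0 add0r mulrC.
by move=> b; rewrite /centered; field.
Qed.

Lemma uexp_centered_clt (u y s : R) : 0 < u -> u <= 1 -> N * u ^+ 8 = 1 ->
  s = Num.sqrt (uexp (fun b => centered b ^+ 2)) ->
  `|uexp (fun b => (centered b / s <= y)%R%:R) - Phi y| <= 73 * u ^+ 2.
Proof.
move=> u0 u1 Nu sE.
have N2 : 2 <= N by rewrite /N ler_nat.
have u4 : 0 < u ^+ 4 by rewrite exprn_gt0.
(* Since [u ^+ 4] is the inverse square root of [N], [c / 16] is the standard deviation of the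
   linear part of [centered]. *)
pose c := 3 * (N - 1) / u ^+ 4.
have c0 : 0 < c by rewrite divr_gt0 ?mulr_gt0//; lra.
have c2 : c ^+ 2 = 9 * (N - 1) ^+ 2 * N.
  have -> : c ^+ 2 = 9 * (N - 1) ^+ 2 / u ^+ 8 by rewrite /c; field; rewrite gt_eqF.
  by congr (_ * _); rewrite -[LHS]mul1r -Nu mulfK// gt_eqF ?exprn_gt0.
set E2 := uexp (fun b : {ffun V -> bool} => (remainder b : R) ^+ 2).
have E2ge0 : 0 <= E2.
  by rewrite -(@uexp_cst R V 0); apply: ler_uexp => b; exact: sqr_ge0.
pose e := E2 / c ^+ 2.
have e0 : 0 <= e by rewrite divr_ge0 ?sqr_ge0.
have eu : e <= 24 * u ^+ 8.
  rewrite ler_pdivrMr ?exprn_gt0//; apply: (le_trans (uexp_remainder_sqr V2)).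
  rewrite -/N c2.
  have -> : 24 * u ^+ 8 * (9 * (N - 1) ^+ 2 * N) = 216 * (N - 1) ^+ 2 * (N * u ^+ 8).
    by ring.
  (* The product equals [4 (N - 1)^2 - N^2]. Thus [54 N^2 <= 216 (N - 1)^2], and 216 = 24 * 9
     explains the constant 24. *)
  rewrite Nu; have : 0 <= (N - 2) * (3 * N - 2) by rewrite mulr_ge0//; lra.
  by lra.
have s2 : s ^+ 2 = (c ^+ 2 + E2) / 256.
  rewrite sE uexp_centered_sqr -/E2 -c2 sqr_sqrtr//.
  by rewrite divr_ge0// addr_ge0// sqr_ge0.
have sge0 : 0 <= s by rewrite sE; exact: sqrtr_ge0.
(* The ratio of the true standard deviation to that of the linear part. Normalising by the latter
   turns the threshold [y] into [r * y], and [1 <= r <= 1 + e]. *)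
pose r := 16 * s / c.
have r0 : 0 <= r by exact: divr_ge0 (mulr_ge0 (ler0n _ _) sge0) (ltW c0).
have r2 : r ^+ 2 = 1 + e.
  by rewrite /r expr_div_n exprMn s2 /e; field; rewrite gt_eqF.
have r1 : 1 <= r by rewrite -(@ler_pXn2r _ 2)// ?nnegrE// r2 expr1n lerDl.
have re : r <= 1 + e.
  rewrite -(@ler_pXn2r _ 2)// ?nnegrE ?addr_ge0// r2 sqrrD.
  by have := sqr_ge0 e; lra.
have s0 : 0 < s.
  rewrite lt_def sge0 andbT; apply: contraTneq r1 => s0.
  by rewrite /r s0 mulr0 mul0r -ltNge.
have -> : uexp (fun b => (centered b / s <= y)%R%:R) =
    uexp (fun b : {ffun V -> bool} =>
      (u ^+ 4 * walk b + remainder b / c <= r * y)%R%:R) :> R.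
  apply: eq_uexp => b; congr (_%:R); congr nat_of_bool.
  rewrite ler_pdivrMr//.
  have -> : u ^+ 4 * walk b + remainder b / c = centered b * (16 / c).
    rewrite /centered /c; field.
    by rewrite !gt_eqF//; lra.
  have -> : r * y = y * s * (16 / c) by rewrite /r; ring.
  by rewrite ler_pM2r// divr_gt0.
set X := fun b : {ffun V -> bool} => u ^+ 4 * walk b.
set Q := fun b : {ffun V -> bool} => remainder b / c.
have EQ : uexp (fun b => Q b ^+ 2) / (u ^+ 2) ^+ 2 <= 24 * u ^+ 2.
  rewrite (@eq_uexp _ _ _ (fun b => (c ^+ 2)^-1 * remainder b ^+ 2)) => [|b]; last first.
    by rewrite /Q expr_div_n mulrC.
  rewrite uexpZ mulrC [_^-1 * E2]mulrC -/e -exprM ler_pdivrMl//.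
  apply: (le_trans eu).
  have -> : u ^+ 4 * (24 * u ^+ 2) = 24 * u ^+ 6 by ring.
  by rewrite ler_wpM2l// ler_wiXn2l// ltW.
have h3 : u ^+ 4 <= u ^+ 3 by rewrite ler_wiXn2l// ltW.
have hN : (u ^+ 4) ^+ 2 * #|V|%:R = 1 by rewrite -exprM mulrC.
have V0 : 0 < u^-1 by rewrite invr_gt0.
have u3 : 0 < u ^+ 3 by rewrite exprn_gt0.
have u2 : 0 < u ^+ 2 by rewrite exprn_gt0.
have up := @uexp_smoothing_upper R V X Q (r * y) (u ^+ 3) u^-1 (u ^+ 2) u3 V0 u2.
have lo := @uexp_smoothing_lower R V X Q (r * y) (u ^+ 3) u^-1 (u ^+ 2) u3 V0 u2.
have Kd : u^-1 * u ^+ 3 = u ^+ 2 by rewrite exprS mulKf// gt_eqF.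
have K2 : 2 / u^-1 ^+ 2 = 2 * u ^+ 2 by rewrite exprVn invrK.
have up' := @uexp_Phi_walk R V _ _ (r * y + u ^+ 2 + u ^+ 2) u4 h3 hN.
have lo' := @uexp_Phi_walk R V _ _ (r * y - u ^+ 2 - u ^+ 2) u4 h3 hN.
have hd : 20 * (u ^+ 4) ^+ 2 / (u ^+ 3) ^+ 2 = 20 * u ^+ 2 by field; rewrite gt_eqF.
have d2 : (u ^+ 3) ^+ 2 <= u ^+ 2 by rewrite -exprM ler_wiXn2l// ltW.
have u8 : u ^+ 8 <= u ^+ 2 by rewrite ler_wiXn2l// ltW.
have ry := Phi_dilate y r r1.
have Pup := @Phi_lipschitz R (r * y) (r * y + u ^+ 2 + u ^+ 2).
have Plo := @Phi_lipschitz R (r * y - u ^+ 2 - u ^+ 2) (r * y).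
move: up lo up' lo' Pup Plo; rewrite Kd K2 hd => up lo up' lo' Pup Plo.
have {}Pup := Pup ltac:(lra); have {}Plo := Plo ltac:(lra).
(* In units of [u^2]: Gaussian tail 2, Chebyshev 24, walk 20 + 1, shift of the threshold 2, dilation
   by [r] 24. The sum is 73. *)
move: ry up lo up' lo' Pup Plo; rewrite !ler_norml.
move=> /andP[? ?] ? ? /andP[? ?] /andP[? ?] /andP[? ?] /andP[? ?].
by apply/andP; split; lra.
Qed.

End rademacher_berry_esseen.

(** * Progressions in the cyclic group of prime order *)

Lemma Zp_double_eq0 (n : nat) : prime n -> odd n ->
  forall j : 'Z_n, j *+ 2 = 0 -> j = 0.
Proof.
move=> pn on j; rewrite -mulr_natr => j2.
have u2 : (2%:R : 'Z_n) \is a GRing.unit.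
  by rewrite unitZpE ?prime_gt1// coprimen2.
by apply: (mulIr u2); rewrite j2 mul0r.
Qed.

Lemma card_Zp_gt1 (n : nat) : (1 < n)%N -> #|'Z_n| = n.
Proof. by move=> n1; rewrite card_ord Zp_cast. Qed.

Section count.
Context {d : measure_display} {T : measurableType d} {R : realType}.
Context {P : probability T R} {n : nat} {x : 'Z_n -> {RV P >-> R}}.
Hypothesis n_prime : prime n.
Hypothesis n_odd : odd n.
Hypothesis x_indep : mutually_independent x.
Hypothesis x_bern : forall i, bernoulli_half (x i).

Let A : T -> R := ap3_count (fun i => x i : T -> R).
Let m : R := n%:R * (n%:R - 1) / 16.

Lemma measurable_ap3_count : measurable_fun setT A.
Proof.
rewrite (_ : A = fun t => 2^-1 * \sum_(i : 'Z_n) \sum_(j : 'Z_n)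
    (if j != 0 then x i t * x (i + j) t * x (i + j *+ 2) t else 0)); last first.
  by apply: funext => t; congr (_ * _); apply: eq_bigr => i _; rewrite big_mkcond.
apply: measurable_funM => //; apply: measurable_sum => i; apply: measurable_sum => j.
by case: (j != 0) => //; apply: measurable_funM => //; apply: measurable_funM.
Qed.

(** On a cylinder every [x i] equals [(1 + e_i) / 2] for the corresponding sign, so the algebraic
    expansion applies, with constant term [m]. *)
Lemma ap3_count_cylinder (b : {ffun 'Z_n -> bool}) t :
  cylinder (x := x) b t -> A t = m + centered b.
Proof.
move=> bt.
have xb i : x i t = (1 + rademacher b i) / 2.
  have -> : x i t = (b i)%:R by have := bt i; rewrite /= inE; apply.
  by rewrite /rademacher; case: (b i); rewrite ?subrr ?mul0r// divff.
have e2 i : rademacher b i ^+ 2 = 1 :> R by exact: rademacher_sqr.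
rewrite /A /ap3_count.
under eq_bigr do under eq_bigr do rewrite !xb.
rewrite (progression_expansion (Zp_double_eq0 n n_prime n_odd) _ e2).
rewrite card_Zp_gt1 ?prime_gt1// /m /centered /remainder card_Zp_gt1 ?prime_gt1//.
by rewrite -/(walk b); ring.
Qed.

Lemma mean_ap3_count : mean P A = m.
Proof.
rewrite /mean unlock (integral_uexp x_indep x_bern _ _ measurable_ap3_count
  ap3_count_cylinder)/=.
rewrite uexpD uexp_cst uexp_centered ?addr0//; exact: Zp_double_eq0.
Qed.

Lemma std_dev_ap3_count :
  std_dev P A = Num.sqrt (uexp (fun b : {ffun 'Z_n -> bool} => centered b ^+ 2)).
Proof.
rewrite /std_dev /variance unlock -/(mean P A) mean_ap3_count unlock.
rewrite (integral_uexp x_indep x_bern _ (fun b => centered b ^+ 2))//.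
  have mA : measurable_fun setT (A \- cst m).
    by apply: measurable_funB => //; exact: measurable_ap3_count.
  exact: measurable_funM.
move=> b t /ap3_count_cylinder At.
by rewrite -[LHS]/((A t - m) * (A t - m)) At addrAC subrr add0r expr2.
Qed.

Lemma measurable_ap3_event (c s y : R) :
  measurable [set t | (A t - c) / s <= y].
Proof.
have mf : measurable_fun setT (fun t => (A t - c) / s).
  apply: measurable_funM => //; apply: measurable_funB => //.
  exact: measurable_ap3_count.
rewrite (_ : [set t | _] = setT `&` (fun t => (A t - c) / s) @^-1` `]-oo, y]).
  by apply: mf => //; exact: measurable_itv.
by rewrite setTI; apply/seteqP; split=> t; rewrite /= in_itv.
Qed.

Lemma probability_ap3_count (s y : R) :
  fine (P [set t | (A t - mean P A) / s <= y]) =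
  uexp (fun b : {ffun 'Z_n -> bool} => (centered b / s <= y)%R%:R).
Proof.
set E := [set t | _].
have mE : measurable E by exact: measurable_ap3_event.
have -> : P E = (\int[P]_t (\1_E t)%:E)%E by rewrite integral_indic// setIT.
rewrite (integral_uexp x_indep x_bern _ (fun b => (centered b / s <= y)%R%:R))//.
move=> b t /ap3_count_cylinder At; rewrite indicE; congr (_%:R); congr nat_of_bool.
have -> : centered b = A t - mean P A by rewrite mean_ap3_count At addrAC subrr add0r.
by apply/idP/idP; rewrite inE.
Qed.

End count.

Theorem theorem1p2 (R : realType) :
  exists C : R, 0 < C /\
    forall (n : nat), prime n ->
    forall (d : measure_display) (T : measurableType d) (P : probability T R)
      (x : 'Z_n -> {RV P >-> R}),
      mutually_independent x ->
      (forall i, bernoulli_half (x i)) ->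
      let A := ap3_count (fun i => x i : T -> R) in
      forall y : R,
        `| fine (P [set t | (A t - mean P A) / std_dev P A <= y])
           - fine (normal_prob 0 1 [set z : R | z <= y]) |
        <= C * n%:R `^ (- 4^-1).
Proof.
exists 73; split=> // n pn d T P x x_indep x_bern A y.
have n0 : 0 < n%:R :> R by rewrite ltr0n prime_gt0.
pose u : R := n%:R `^ (- 8^-1).
have u0 : 0 < u by rewrite powR_gt0.
have nu : n%:R * u ^+ 8 = 1.
  rewrite -powR_mulrn ?ltW// /u -powRrM mulNr mulVf// powR_inv1 ?ltW//.
  by rewrite divff// gt_eqF.
have u1 : u <= 1.
  rewrite leNgt; apply/negP => u1; have : 1 < n%:R * u ^+ 8; last by rewrite nu ltxx.
  by rewrite mulr_egt1// ?ltr1n ?prime_gt1// exprn_egt1.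
have -> : n%:R `^ (- 4^-1) = u ^+ 2.
  by rewrite -powR_mulrn ?ltW// /u -powRrM; congr (_ `^ _); field.
have [n_odd|n_even] := boolP (odd n).
  rewrite (probability_ap3_count pn n_odd x_indep x_bern).
  apply: uexp_centered_clt => //.
  - exact: Zp_double_eq0.
  - by rewrite card_Zp_gt1 prime_gt1.
  - by rewrite card_Zp_gt1 ?prime_gt1.
  - exact: std_dev_ap3_count.
have n2 : n = 2%N by case: (even_prime pn) n_even => [|->].
(* Here [u ^+ 8 = 1/2], whereas [u ^+ 2 < 1/73] would force [u ^+ 8 < 1/16]. *)
have u2 : 1 <= 73 * u ^+ 2.
  rewrite leNgt; apply/negP => u2.
  have : (u ^+ 2) ^+ 4 < (2^-1) ^+ 4.
    by rewrite ltrXn2r// ?nnegrE ?exprn_ge0 ?ltW//; lra.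
  by move: nu; rewrite -exprM n2; lra.
apply: le_trans u2; rewrite -/(Phi y).
have := Phi_ge0 y; have := Phi_le1 y.
have mE := @measurable_ap3_event _ _ _ _ _ x (mean P A) (std_dev P A) y.
have : fine (P [set t | (A t - mean P A) / std_dev P A <= y]) <= 1.
  by rewrite -lee_fin fineK ?fin_num_measure// probability_le1.
have : 0 <= fine (P [set t | (A t - mean P A) / std_dev P A <= y]).
  by rewrite fine_ge0.
by rewrite ler_norml => *; apply/andP; split; lra.
Qed.
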